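(* For each $n\ge1$, choose permutations $u_n,v_n\in\mathfrak S_n$ independently and uniformly at random. The expected number of inversions of $u_n\star v_n$ satisfies $$\mathbb E[\ell(u_n\star v_n)]=\binom n2(1-o(1))\qquad (n\to\infty).$$
   Context: $\mathfrak S_n$ is the symmetric group. For $v\in\mathfrak S_n$, $\ell(v)$ is the number of inversions of $v$, i.e. pairs $(a,b)$ with $a<b$ and $v^{-1}(a)>v^{-1}(b)$. Let $s_i=(i\;\,i+1)$. For $1\le i\le n-1$, let $\tau_i(u)=us_i$ if $\ell(us_i)>\ell(u)$ and $\tau_i(u)=u$ otherwise. The Demazure product $\star$ is the unique associative product on $\mathfrak S_n$ satisfying $u\star s_i=\tau_i(u)$ for all $u\in\mathfrak S_n$ and $1\le i\le n-1$. *)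

(* Defs.v *)
From HB Require Import structures.
From mathcomp Require Import all_boot all_order all_algebra all_fingroup.
From mathcomp Require Import zify.
From mathcomp Require Import all_classical reals.

Set Implicit Arguments.
Unset Strict Implicit.
Unset Printing Implicit Defensive.

Import Order.TTheory GRing.Theory Num.Theory.

Section Demazure.
Local Open Scope nat_scope.
Variable n : nat.
Implicit Types (u v w : 'S_n) (i j : 'I_n).

(* MathComp multiplies permutations left to right, [(s * t) x = t (s x)];
   this is the usual right-to-left composition, [comp_perm u v x = u (v x)]. *)
Definition comp_perm u v : 'S_n := (v * u)%g.

Definition ninv v : nat :=
  #|[set p : 'I_n * 'I_n | (p.1 < p.2) && ((v^-1)%g p.2 < (v^-1)%g p.1)]|.

(* The simple transposition (i i+1) is [tperm i j] where j = i + 1; passing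
   both points avoids building the ordinal i + 1. *)
Definition tau i j u : 'S_n :=
  if ninv u < ninv (comp_perm u (tperm i j)) then comp_perm u (tperm i j)
  else u.

Definition is_demazure (star : 'S_n -> 'S_n -> 'S_n) : Prop :=
  associative star /\
  forall u i j, j = i.+1 :> nat -> star u (tperm i j) = tau i j u.

(* The rest of the section checks that [is_demazure] pins down a product: one
   exists for every n, it has unit 1, and it is unique unless n = 2. *)
Lemma ninvE v :
  ninv v = #|[set p : 'I_n * 'I_n | (p.1 < p.2) && (v p.2 < v p.1)]|.
Proof.
pose f (p : 'I_n * 'I_n) := (v p.2, v p.1).
have fi : injective f by move=> [a b] [c d] [] /perm_inj -> /perm_inj ->.
rewrite -[RHS](card_imset _ fi); congr #|pred_of_set _|; apply/setP => -[a b].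
rewrite inE /=; apply/idP/imsetP => [/andP[ab ba]|[[c d]]].
  by exists ((v^-1)%g b, (v^-1)%g a); rewrite ?inE /f /= ?permKV // ba ab.
by rewrite inE /= => /andP[cd dc] [-> ->]; rewrite !permK dc cd.
Qed.

Lemma ninvV v : ninv (v^-1)%g = ninv v.
Proof. by rewrite ninvE. Qed.

Lemma tperm_val i j x :
  tperm i j x = (if x == i :> nat then j else if x == j :> nat then i else x)
    :> nat.
Proof.
case: tpermP => [->|->|/eqP + /eqP]; rewrite ?eqxx //.
  by case: eqP => // ->.
by rewrite -!(inj_eq val_inj) /= => /negPf -> /negPf ->.
Qed.

Lemma ninv_tperm i j u : j = i.+1 :> nat -> u i < u j ->
  ninv (tperm i j * u)%g = (ninv u).+1.
Proof.
move=> ij uij; rewrite !ninvE (cardsD1 (i, j)) inE /= !permM tpermL tpermR.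
rewrite uij ij ltnSn add1n; congr _.+1.
pose f (p : 'I_n * 'I_n) := (tperm i j p.1, tperm i j p.2).
have fK : involutive f by case=> a b; rewrite /f /= !tpermK.
rewrite -[RHS](card_imset _ (inv_inj fK)); congr #|pred_of_set _|.
apply/setP => p; rewrite -[p in RHS]fK mem_imset ?inE; last exact: inv_inj.
case: p => a b; rewrite /= !permM.
rewrite andbA; have [lt_u|_] := ltnP (u (tperm i j b)); last by rewrite !andbF.
rewrite !andbT xpair_eqE -!(inj_eq val_inj) /= !tperm_val.
have nji : ~~ ((a == j :> nat) && (b == i :> nat)).
  apply/negP => /andP[/eqP/val_inj ea /eqP/val_inj eb].
  by move: lt_u; rewrite ea eb tpermL tpermR ltnNge ltnW.
by move: nji; repeat case: eqP; lia.
Qed.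

Lemma perm_ltn u i j : i != j :> nat -> u i <= u j -> u i < u j.
Proof.
by move=> nij le_u; rewrite ltn_neqAle le_u !(inj_eq val_inj, inj_eq perm_inj) andbT.
Qed.

Lemma tauE i j u : j = i.+1 :> nat ->
  tau i j u = if u i < u j then (tperm i j * u)%g else u.
Proof.
move=> ij; rewrite /tau /comp_perm; case: ltnP => [uij|].
  case: ltnP => // uji.
  have {}uji : u j < u i by apply: perm_ltn uji; lia.
  have := @ninv_tperm i j (tperm i j * u)%g ij.
  rewrite !permM tpermL tpermR mulgA tperm2 mul1g => /(_ uji) e.
  by move: uij; rewrite e => /ltnW; rewrite ltnn.
by case: ltnP => // /(ninv_tperm ij) ->; rewrite ltnn.
Qed.

Let cotau i j u : 'S_n := ((tau i j u^-1)^-1)%g.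

Lemma cotauE i j u : j = i.+1 :> nat ->
  cotau i j u = if (u^-1)%g i < (u^-1)%g j then (u * tperm i j)%g else u.
Proof.
by move=> ij; rewrite /cotau tauE //; case: ifP; rewrite ?invMg ?invgK ?tpermV.
Qed.

Lemma tau_cotau i j (k l : 'I_n) u : j = i.+1 :> nat -> l = k.+1 :> nat ->
  tau i j (cotau k l u) = cotau k l (tau i j u).
Proof.
move=> ij kl; rewrite !tauE // !cotauE //.
have H (a b : 'I_n) : ~~ ((a == k) && (b == l)) -> ~~ ((a == l) && (b == k)) ->
    (tperm k l a < tperm k l b) = (a < b).
  by rewrite -!(inj_eq val_inj) /= !tperm_val; repeat case: eqP; lia.
have H' (a b : 'I_n) : ~~ ((a == i) && (b == j)) -> ~~ ((a == j) && (b == i)) ->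
    (tperm i j a < tperm i j b) = (a < b).
  by rewrite -!(inj_eq val_inj) /= !tperm_val; repeat case: eqP; lia.
have nij : i != j by rewrite -val_eqE /=; lia.
have [/andP[/eqP ui /eqP uj]|n1] := boolP ((u i == k) && (u j == l)).
  have -> : (u^-1)%g k = i by rewrite -ui permK.
  have -> : (u^-1)%g l = j by rewrite -uj permK.
  have -> : i < j by lia.
  have -> : u i < u j by rewrite ui uj; lia.
  have -> : (u * tperm k l)%g i = l by rewrite permM ui tpermL.
  have -> : (u * tperm k l)%g j = k by rewrite permM uj tpermR.
  have Vk : ((tperm i j * u)^-1)%g k = j.
    by rewrite -ui invMg tpermV permM permK tpermL.
  have Vl : ((tperm i j * u)^-1)%g l = i.
    by rewrite -uj invMg tpermV permM permK tpermR.
  rewrite Vk Vl.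
  have -> : (l < k) = false by lia.
  have -> : (j < i) = false by lia.
  by rewrite -ui -uj -tpermJ conjgE mulgA mulgV mul1g.
have [/andP[/eqP ui /eqP uj]|n2] := boolP ((u i == l) && (u j == k)).
  have -> : (u^-1)%g l = i by rewrite -ui permK.
  have -> : (u^-1)%g k = j by rewrite -uj permK.
  have -> : (j < i) = false by lia.
  have -> : (u i < u j) = false by rewrite ui uj; lia.
  have -> : (u^-1)%g l = i by rewrite -ui permK.
  have -> : (u^-1)%g k = j by rewrite -uj permK.
  by have -> : (j < i) = false by lia.
have E1 : ((u * tperm k l)%g i < (u * tperm k l)%g j) = (u i < u j).
  by rewrite !permM H.
have E2 : (((tperm i j * u)^-1)%g k < ((tperm i j * u)^-1)%g l) =
          ((u^-1)%g k < (u^-1)%g l).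
  rewrite invMg !permM tpermV H' //.
    apply: contra n1 => /andP[/eqP <- /eqP <-]; by rewrite !permKV !eqxx.
  apply: contra n2 => /andP[/eqP <- /eqP <-]; by rewrite !permKV !eqxx.
case h1: ((u^-1)%g k < (u^-1)%g l); case h2: (u i < u j);
  by rewrite ?E1 ?E2 ?h1 ?h2 ?mulgA.
Qed.

Let act (s : seq ('I_n * 'I_n)) u : 'S_n := foldl (fun x p => tau p.1 p.2 x) u s.
Let adj (s : seq ('I_n * 'I_n)) := all (fun p : 'I_n * 'I_n => p.2 == p.1.+1 :> nat) s.

Lemma descent v : v != 1%g -> exists i j, j = i.+1 :> nat /\ v j < v i.
Proof.
move=> v1; have [/existsP[[i j] /= /andP[/eqP ij h]]|/existsPn h] :=
  boolP [exists p : 'I_n * 'I_n, (p.2 == p.1.+1 :> nat) && (v p.2 < v p.1)].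
  by exists i, j.
case/eqP: v1.
have lt_v d : forall i j, j = (i + d).+1 :> nat -> v i < v j.
  elim: d => [|d IH] i j ij.
    have := h (i, j); rewrite /= ij addn0 eqxx /= -leqNgt => le_v.
    by apply: perm_ltn le_v; rewrite /=; lia.
  have kn : (i + d).+1 < n by have := ltn_ord j; lia.
  apply: ltn_trans (IH i (Ordinal kn) erefl) _.
  have := h (Ordinal kn, j); rewrite /= ij addnS eqxx /= -leqNgt => le_v.
  by apply: perm_ltn le_v; rewrite /=; lia.
have up m : forall i, i = m :> nat -> i <= v i.
  elim: m => [|m IH] i im; first by rewrite im.
  have mn : m < n by have := ltn_ord i; lia.
  have := IH (Ordinal mn) erefl; have := @lt_v 0 (Ordinal mn) i.
  by rewrite /= addn0 => /(_ im); lia.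
have down m : forall i, (i + m).+1 = n -> v i <= i.
  elim: m => [|m IH] i im; first by have := ltn_ord (v i); lia.
  have mn : i.+1 < n by lia.
  have := IH (Ordinal mn); have := @lt_v 0 i (Ordinal mn).
  by rewrite /= addn0 => /(_ erefl) ? /(_ ltac:(lia)); lia.
apply/permP => i; rewrite perm1; apply/val_inj/eqP; rewrite /= eqn_leq (up i) //.
by rewrite (down (n - i.+1)) //; have := ltn_ord i; lia.
Qed.

Lemma act_surj v : exists s, adj s && (act s 1%g == v).
Proof.
have [m le_m] := ubnP (ninv v); elim: m v le_m => // m IH v le_m.
have [->|/descent[i [j [ij vji]]]] := eqVneq v 1%g.
  by exists [::]; rewrite /= eqxx.
have h : (tperm i j * v)%g i < (tperm i j * v)%g j.
  by rewrite !permM tpermL tpermR.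
have := ninv_tperm ij h; rewrite mulgA tperm2 mul1g => e.
have [|s /andP[sa /eqP es]] := IH (tperm i j * v)%g; first by lia.
exists (rcons s (i, j)); rewrite /adj all_rcons /= ij eqxx /= -/(adj s) sa /=.
by rewrite /act foldl_rcons -/(act s _) es /= tauE // h mulgA tperm2 mul1g.
Qed.

Lemma act_cotau s (k l : 'I_n) u : adj s -> l = k.+1 :> nat ->
  act s (cotau k l u) = cotau k l (act s u).
Proof.
move=> + kl; elim: s u => //= -[i j] s IH u /andP[/eqP ij sa].
by rewrite /= tau_cotau // IH.
Qed.

Lemma act_inj s t u : adj s -> adj t -> act s 1%g = act t 1%g ->
  act s u = act t u.
Proof.
move=> sa ta st; have [r /andP[ra /eqP er]] := act_surj (u^-1)%g.
rewrite -[u]invgK -er; elim/last_ind: r {u er} ra => [|r [k l] IH].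
  by rewrite invg1.
rewrite /adj all_rcons /= => /andP[/eqP kl ra].
have -> : ((act (rcons r (k, l)) 1)^-1)%g = cotau k l ((act r 1)^-1)%g.
  by rewrite /act foldl_rcons /cotau invgK.
by rewrite !act_cotau // IH.
Qed.

Lemma tau1 i j : j = i.+1 :> nat -> tau i j 1%g = tperm i j.
Proof. by move=> ij; rewrite tauE // !perm1 ij ltnSn mulg1. Qed.

Lemma demazure_exists : exists star,
  [/\ is_demazure star, left_id 1%g star & right_id 1%g star].
Proof.
pose word v := xchoose (act_surj v).
have wa v : adj (word v) by have /andP[] := xchooseP (act_surj v).
have wE v : act (word v) 1%g = v by have /andP[_ /eqP] := xchooseP (act_surj v).
have act_cat s t u : act (s ++ t) u = act t (act s u) by rewrite /act foldl_cat.
exists (fun u v => act (word v) u); split.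
- split=> [u v w | u i j ij].
    rewrite -act_cat; apply: act_inj => //; first by rewrite /adj all_cat; apply/andP.
    by rewrite wE act_cat wE.
  by apply: (@act_inj _ [:: (i, j)]); rewrite /adj //= ?ij ?eqxx // wE tau1.
- by move=> v; rewrite wE.
- by move=> u; apply: (@act_inj _ [::]); rewrite ?wE.
Qed.

(* For n = 2 the two axioms do not fix the value of [star u 1]: the constant
   product equal to the transposition satisfies them too. *)
Lemma demazure_unique star star' : n != 2 ->
  is_demazure star -> is_demazure star' -> star =2 star'.
Proof.
move=> n2 ds ds'.
have H st : is_demazure st -> forall u s, adj s -> st u (act s 1%g) = act s u.
  case=> stA stE u.
  have st1 x : st x 1%g = x.
    have [n1|n3] : n <= 1 \/ 2 < n by lia.
      by apply/permP => i; apply: val_inj => /=;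
        have := ltn_ord (st x 1%g i); have := ltn_ord (x i); lia.
    have n0 : 0 < n by lia.
    have n1 : 1 < n by lia.
    pose a := Ordinal n0; pose b := Ordinal n1; pose c := Ordinal n3.
    have E i j : j = i.+1 :> nat -> tau i j (st x 1%g) = tau i j x.
      by move=> ij; rewrite -!stE // -stA stE // tau1.
    have K i j : j = i.+1 :> nat -> st x 1%g = x \/ st x 1%g = (tperm i j * x)%g.
      move=> ij; have := E i j ij; rewrite !tauE //.
      case: ifP => _; case: ifP => _; [by move/mulgI; left | | by right | by left].
      by move=> e; right; rewrite -[x in RHS]e mulgA tperm2 mul1g.
    have [//|e1] := K a b erefl; have [//|] := K b c erefl.
    by rewrite e1 => /mulIg/permP/(_ a); rewrite tpermL tpermD.
  elim/last_ind => [|s [i j] IH]; first by rewrite st1.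
  rewrite /adj all_rcons /= => /andP[/eqP ij sa].
  by rewrite /act !foldl_rcons /= -!stE // stA -/(act s _) IH.
move=> u v; have [s /andP[sa /eqP <-]] := act_surj v.
by rewrite !H.
Qed.

End Demazure.

Local Open Scope ring_scope.

(* Expectation of f under the uniform distribution on T; for a pair type this
   is the law of two independent uniform elements. *)
Definition unif_mean (R : realType) (T : finType) (f : T -> R) : R :=
  (\sum_(x : T) f x) / #|T|%:R.

(* Main.v *)
(* Let rk v i j count the a < i with v a < j.  The Demazure product satisfies
   rk (u * v) i j <= max_k (rk v i k + rk u k j - k), by induction on a word
   for v.  For uniform v, rk v i k is i k / n + o(n) in mean, uniformly in
   i and k (negative correlation and a second moment bound on a coarse grid), so
   rk (u * v) i j <= max_k (k / n) (i + j - n) + o(n) = (i + j - n)^+ + o(n).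
   The number of non-inversions of w is sum_b rk w b (w b), and
   sum_b (b + w b - n)^+ = sum_t (rk w (t + 1) (n - t) - 1); both sums are thus
   o(n^2) for w = u * v. *)
Require Import Defs.
From mathcomp Require Import all_boot all_order all_algebra all_fingroup.
From mathcomp Require Import all_classical reals topology normedtype.
From mathcomp Require Import zify ring lra.

Set Implicit Arguments.
Unset Strict Implicit.
Unset Printing Implicit Defensive.

Import Order.TTheory GRing.Theory Num.Theory.
Import numFieldNormedType.Exports.

Local Open Scope classical_set_scope.
Local Open Scope ring_scope.

(** * Rank functions, and how the Demazure product changes them *)

Section RankFunction.
Local Open Scope nat_scope.
Variable n : nat.
Implicit Types (u v w : 'S_n) (i j k : nat).

Definition rk v i j : nat := \sum_(a < n | a < i) (v a < j).

Lemma rkS v (p : 'I_n) j : rk v p.+1 j = rk v p j + (v p < j).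
Proof.
rewrite /rk (bigD1 p) ?ltnSn //= addnC; congr (_ + _); apply: eq_bigl => a.
by rewrite -val_eqE /=; lia.
Qed.

Lemma rk_tperm (p q : 'I_n) w i j : q = p.+1 :> nat -> i != p.+1 ->
  rk (tperm p q * w)%g i j = rk w i j.
Proof.
move=> pq ip; rewrite /rk (reindex_inj (@perm_inj _ (tperm p q))) /=.
by apply: eq_big => [a|a _]; rewrite ?permM ?tpermK // tperm_val; do 2?case: eqP; lia.
Qed.

Lemma rk_tau_neq (p q : 'I_n) w i j : q = p.+1 :> nat -> i != p.+1 ->
  rk (tau p q w) i j = rk w i j.
Proof. by move=> pq ip; rewrite tauE //; case: ifP => // _; rewrite rk_tperm. Qed.

Lemma tau_descent (p q : 'I_n) w : q = p.+1 :> nat -> tau p q w q < tau p q w p.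
Proof.
move=> pq; rewrite tauE //; case: ifP => [|/negbT]; first by rewrite !permM tpermL tpermR.
by rewrite -leqNgt => h; apply: perm_ltn h; rewrite pq; lia.
Qed.

(** [tau] puts entries p and p + 1 in descending order and keeps rows p and p + 2 of [rk]. If just
    one of the two entries is below j, it is the later one; so row p + 1 exceeds row p only when
    both are, and it is then row p + 2 less one. *)
Lemma rk_tau (p q : 'I_n) w j : q = p.+1 :> nat ->
  rk (tau p q w) p.+1 j = maxn (rk w p j) (rk w p.+2 j).-1.
Proof.
move=> pq; have := tau_descent w pq.
have e1 := rkS (tau p q w) p j; have e2 := rkS (tau p q w) q j.
rewrite pq in e2; move: e1 e2.
by rewrite (@rk_tau_neq p q w p) ?(@rk_tau_neq p q w p.+2) //; lia.
Qed.

Lemma rk1 i : i <= n -> rk 1%g i i = i.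
Proof.
move=> le_in; rewrite /rk (eq_bigr (fun=> 1)) => [|a]; last by rewrite perm1 => ->.
by rewrite -(big_ord_widen _ (fun=> 1)) // sum1_card card_ord.
Qed.

Lemma demazure_right1 (star : 'S_n -> 'S_n -> 'S_n) : n != 2 ->
  is_demazure star -> right_id 1%g star.
Proof.
move=> n2 ds u; have [star' [ds' _ r1]] := demazure_exists n.
by rewrite (demazure_unique n2 ds ds').
Qed.

(* In fact rk (star u v) i j is the maximum over k of the right-hand side
   minus k (a max-plus matrix product); only this bound is needed. *)
Lemma rk_star (star : 'S_n -> 'S_n -> 'S_n) u v i j : n != 2 ->
  is_demazure star -> i <= n ->
  exists2 k, k <= n & rk (star u v) i j + k <= rk v i k + rk u k j.
Proof.
move=> n2 ds; have s1 := demazure_right1 n2 ds; case: ds => sA sE.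
have [s /andP[sa /eqP <-]] := act_surj v.
elim/last_ind: s sa i => [_ i le_in|s [p q] IH].
  by exists i => //; rewrite s1 rk1 // addnC.
rewrite all_rcons foldl_rcons /= => /andP[/eqP pq /IH{}IH] i le_in.
set x := foldl _ _ _ in IH *.
rewrite -(sE x) // sA !sE //.
have [->|ip] := eqVneq i p.+1; last first.
  by have [k lek h] := IH i le_in; exists k; rewrite ?rk_tau_neq.
have [k lek hk] := IH p ltac:(by have := ltn_ord p; lia).
have [l lel hl] := IH p.+2 ltac:(by have := ltn_ord q; lia).
(* By [rk_tau], row p + 1 of the new product is row p of [star u x], or its row p + 2 less one. The
   witness for that row still works, since row p + 1 of [tau p q x] dominates both analogues for
   x. *)
have [le|lt] := leqP (rk (star u x) p.+2 j).-1 (rk (star u x) p j).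
  by exists k => //; rewrite !rk_tau //; lia.
by exists l => //; rewrite !rk_tau //; lia.
Qed.

Definition ncoinv w : nat := \sum_(b < n) rk w b (w b).

Lemma ninv_ncoinv w : ninv w + ncoinv w = 'C(n, 2).
Proof.
rewrite -bin2_sum big_mkord ninvE -sum1_card.
under eq_bigl do rewrite inE.
rewrite -(pair_big_dep xpredT (fun a b : 'I_n => (a < b) && (w b < w a)) (fun _ _ => 1)) /=.
rewrite (exchange_big_dep xpredT) //= -big_split /=; apply: eq_bigr => b _.
rewrite /rk big_mkcondr /= -big_split /= (eq_bigr (fun=> 1)) => [|a ab].
  by rewrite -(big_ord_widen _ (fun=> 1)) ?sum1_card ?card_ord // ltnW.
have : w a != w b :> nat by rewrite (inj_eq val_inj) (inj_eq perm_inj) -val_eqE /=; lia.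
by case: ifP; lia.
Qed.

Lemma sum_ord_lt m : m <= n -> \sum_(a < n) (a < m) = m.
Proof.
move=> le_mn; rewrite -[RHS](card_ord m) -sum1_card (big_ord_widen _ (fun=> 1) le_mn).
by rewrite [RHS]big_mkcond; apply: eq_bigr => a _; case: ltnP.
Qed.

Lemma sum_perm_lt w m : m <= n -> \sum_(a < n) (w a < m) = m.
Proof.
by move=> le_mn; rewrite -[RHS]sum_ord_lt // [RHS](reindex_inj (@perm_inj _ w)).
Qed.

(** [b + w b - n] counts the t < n with t < b and n - t <= w b. For fixed t, inclusion-exclusion
    counts such b as n - (t + 1) - (n - t) + rk w (t + 1) (n - t). *)
Lemma sum_above w : \sum_(b < n) (b + w b - n) = \sum_(t < n) (rk w t.+1 (n - t)).-1.
Proof.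
have -> : \sum_(b < n) (b + w b - n) = \sum_(b < n) \sum_(t < n) ((t < b) && (n - t <= w b)).
  apply: eq_bigr => b _.
  have := sum_ord_lt (ltnW (ltn_ord b)); have := @sum_ord_lt (minn b (n - w b)).
  move=> /(_ ltac:(lia)) e1 e2.
  have : \sum_(t < n) (t < minn b (n - w b)) + \sum_(t < n) ((t < b) && (n - t <= w b)) = b.
    rewrite -[RHS]e2 -big_split; apply: eq_bigr => t _ /=.
    by have := ltn_ord t; have := ltn_ord (w b); lia.
  by rewrite e1; move: (\sum_(_ < n) _) (ltn_ord (w b)) => S; lia.
rewrite exchange_big; apply: eq_bigr => t _ /=.
have : \sum_(b < n) ((t < b) && (n - t <= w b)) + \sum_(b < n) (b < t.+1) +
    \sum_(b < n) (w b < n - t) = \sum_(b < n) 1 + rk w t.+1 (n - t).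
  rewrite /rk [X in _ = _ + X]big_mkcond /= -!big_split; apply: eq_bigr => b _ /=.
  by case: ifP; lia.
rewrite sum_ord_lt ?ltn_ord // sum_perm_lt ?leq_subr // sum1_card card_ord.
by move: (\sum_(_ < n) _) (rk _ _ _) (ltn_ord t) => S r; lia.
Qed.

End RankFunction.

(** * From a uniform bound on ranks to a bound on non-inversions *)

Section Coinversions.
Variables (R : realDomainType) (n : nat).
Implicit Types (w : 'S_n).

(** [sum_above] turns the sum of the main terms b + w b - n into ranks on the line i + j = n + 1,
    where the hypothesis allows at most 1 + e. So e is paid twice for each of the n indices. *)
Lemma ncoinv_le w (e : R) :
    (forall i j, (i <= n)%N -> (j <= n)%N ->
      (rk w i j)%:R <= (i + j - n)%:R + e) ->
  (ncoinv w)%:R <= 2 * n%:R * e.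
Proof.
move=> rk_le.
have above : (\sum_(b < n) (b + w b - n))%N%:R <= n%:R * e.
  rewrite sum_above natr_sum mulr_natl -[n in X in _ <= X](card_ord n) -sumr_const.
  apply: ler_sum => t _; have := rk_le t.+1 (n - t)%N (ltn_ord t) (leq_subr _ _).
  have -> : (t.+1 + (n - t) - n = 1)%N by have := ltn_ord t; lia.
  case: (rk w t.+1 (n - t)%N) (rkS w t (n - t)) => [|m] /=.
    (* The predecessor of 0 is 0, so this case needs 0 <= e, which is the hypothesis at i = j =
       0. *)
    have := rk_le 0%N 0%N (leq0n _) (leq0n _).
    by rewrite /rk big_pred0 // addn0 sub0n add0r.
  by rewrite -natr1; lra.
rewrite -mulrA mulr2n mulrDl mul1r; apply: le_trans (lerD above (lexx _)).
rewrite mulr_natl -[n in X in _ <= _ + X](card_ord n) -sumr_const /ncoinv !natr_sum.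
rewrite -big_split /=.
by apply: ler_sum => b _; apply: rk_le; apply: ltnW.
Qed.

End Coinversions.

(** * Discrepancy of a random permutation: second moment and Lipschitz bounds *)

Section Discrepancy.
Variables (R : realFieldType) (n : nat).
Implicit Types (v w : 'S_n) (g : 'I_n -> R).

Lemma sum_perm_mul g (s : 'S_n) (a b : 'I_n) :
  \sum_(v : 'S_n) g (v (s a)) * g (v (s b)) = \sum_(v : 'S_n) g (v a) * g (v b).
Proof.
rewrite [RHS](reindex_inj (mulgI s)) /=.
by apply: eq_bigr => v _; rewrite !permM.
Qed.

(* The correlations of g (v a) with g (v b), b != a, are all equal, and they
   sum to minus the variance of g (v a). *)
Lemma sum_perm_mul_le0 g (a b : 'I_n) : \sum_x g x = 0 -> a != b ->
  \sum_(v : 'S_n) g (v a) * g (v b) <= 0.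
Proof.
move=> g0 ab; set F := fun c => \sum_(v : 'S_n) g (v a) * g (v c).
have : \sum_c F c = 0.
  rewrite /F exchange_big /= big1 // => v _.
  by rewrite -mulr_sumr; move: g0; rewrite (reindex_inj (@perm_inj _ v)) => ->; rewrite mulr0.
have FE c : c != a -> F c = F b.
  move=> ca; rewrite /F -(sum_perm_mul g (tperm b c) a b).
  by rewrite tpermL tpermD // eq_sym // eq_sym.
rewrite (bigD1 a) //= (eq_bigr (fun=> F b)) => [|c /FE //].
rewrite sumr_const => e.
have Fa : 0 <= F a by apply: sumr_ge0 => v _; rewrite -expr2 sqr_ge0.
have : F b *+ #|[pred c | c != a]| <= 0 by move: e Fa; rewrite /=; lra.
rewrite pmulrn_lle0 //; apply/card_gt0P; exists b.
by rewrite inE eq_sym.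
Qed.

(** Expand the square: off-diagonal terms are nonpositive by [sum_perm_mul_le0], and each of the at
    most n diagonal terms averages to at most 1. *)
Lemma sum_perm_sqr_le g (A : pred 'I_n) :
    \sum_x g x = 0 -> (forall x, `|g x| <= 1) ->
  \sum_(v : 'S_n) (\sum_(a | A a) g (v a)) ^+ 2 <= n%:R * #|{: 'S_n}|%:R.
Proof.
move=> g0 g1.
have -> : \sum_(v : 'S_n) (\sum_(a | A a) g (v a)) ^+ 2 =
    \sum_(a | A a) \sum_(b | A b) \sum_(v : 'S_n) g (v a) * g (v b).
  rewrite exchange_big /=; under eq_bigr do rewrite exchange_big /=.
  rewrite exchange_big /=; apply: eq_bigr => v _.
  rewrite expr2 mulr_suml exchange_big /=; apply: eq_bigr => a _; rewrite mulr_sumr.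
  by apply: eq_bigr => b _; rewrite mulrC.
apply: (@le_trans _ _ (\sum_(a : 'I_n | A a) #|{: 'S_n}|%:R)); last first.
  rewrite sumr_const -[leLHS]mulr_natl ler_wpM2r // ler_nat.
  by rewrite -[n in (_ <= n)%N](card_ord n) max_card.
apply: ler_sum => a Aa; rewrite (bigD1 a) //= -[leRHS]addr0 lerD //; last first.
  by apply: sumr_le0 => b /andP[_ ba]; apply: sum_perm_mul_le0; rewrite // eq_sym.
rewrite -sumr_const; apply: ler_sum => v _.
by rewrite -expr2 -real_normK ?num_real // expr_le1.
Qed.

(** Deviation of [rk v i k] from its mean i k / n (see [discE]), kept as a sum of centred terms so
    that [sum_perm_sqr_le] applies. *)
Definition disc v i k : R := \sum_(a < n | (a < i)%N) ((v a < k)%N%:R - k%:R / n%:R).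

Lemma discE v i k : (i <= n)%N -> disc v i k = (rk v i k)%:R - i%:R * k%:R / n%:R.
Proof.
move=> le_in; rewrite /disc sumrB natr_sum; congr (_ - _).
by rewrite -(big_ord_widen _ (fun=> k%:R / n%:R) le_in) sumr_const card_ord
  -[LHS]mulr_natl mulrA.
Qed.

Lemma sum_disc_sqr_le i k : (0 < n)%N -> (k <= n)%N ->
  \sum_(v : 'S_n) disc v i k ^+ 2 <= n%:R * #|{: 'S_n}|%:R.
Proof.
move=> n0 kn; have n0' : (0 : R) < n%:R by rewrite ltr0n.
apply: (@sum_perm_sqr_le (fun x : 'I_n => (x < k)%N%:R - k%:R / n%:R)) => [|x].
  rewrite sumrB -natr_sum sum_ord_lt // sumr_const card_ord -[X in _ - X]mulr_natl.
  by field; lra.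
have : 0 <= k%:R / n%:R :> R by rewrite divr_ge0.
have : k%:R / n%:R <= 1 :> R by rewrite ler_pdivrMr // mul1r ler_nat.
by case: (x < k)%N => h0 h1; rewrite ler_norml /= ?mulr1n ?mulr0n; apply/andP; split; lra.
Qed.

Lemma rk_leD v i i' j : (i <= i')%N -> (i' <= n)%N ->
  (rk v i j <= rk v i' j <= rk v i j + (i' - i))%N.
Proof.
elim: i' => [|p IH]; first by rewrite leqn0 => /eqP -> _; rewrite subnn addn0 leqnn.
rewrite leq_eqVlt => /orP[/eqP -> _|ip pn]; first by rewrite subnn addn0 leqnn.
have := IH ip (ltnW pn); have := rkS v (Ordinal pn) j => /= ->.
by case: (_ < j)%N; lia.
Qed.

Lemma rk_leDr v i j j' : (j <= j')%N -> (j' <= n)%N ->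
  (rk v i j <= rk v i j' <= rk v i j + (j' - j))%N.
Proof.
move=> jj' j'n; apply/andP; split.
  by apply: leq_sum => a _; case: (ltnP _ j); case: ltnP; lia.
(* Over all positions exactly j' - j values lie in [j, j'); those at positions a < i are no more
   numerous. *)
have := @sum_perm_lt n v j' j'n; have := @sum_perm_lt n v j (leq_trans jj' j'n) => e1 e2.
suff : (rk v i j' + \sum_(a < n) (v a < j) <= rk v i j + \sum_(a < n) (v a < j'))%N by lia.
rewrite /rk !(big_mkcond (fun a : 'I_n => (a < i)%N)) -!big_split /=.
by apply: leq_sum => a _; case: ifP => _; case: (ltnP _ j); case: ltnP; lia.
Qed.

(** Both [rk] and i k / n are nondecreasing with slope at most 1 in each variable, so both
    increments lie between 0 and the bound, and hence so does the size of their difference. *)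
Lemma disc_lipschitz v i i' k k' : (0 < n)%N -> (i <= i' <= n)%N -> (k <= k' <= n)%N ->
  `|disc v i' k' - disc v i k| <= (i' - i)%:R + (k' - k)%:R.
Proof.
move=> n0 /andP[ii' i'n] /andP[kk' k'n]; have n0' : (0 : R) < n%:R by rewrite ltr0n.
rewrite !discE //; last exact: leq_trans i'n.
have /andP[] := rk_leD v k ii' i'n; have /andP[] := rk_leDr v i' kk' k'n.
rewrite -!(ler_nat R) !natrD !natrB //.
have ge0 (x y : R) : 0 <= x -> 0 <= y -> 0 <= x * y / n%:R.
  by move=> x0 y0; rewrite !mulr_ge0 // invr_ge0 ltW.
have le1 (x y : R) : x <= n%:R -> 0 <= y -> x * y / n%:R <= y.
  by move=> xn y0; rewrite ler_pdivrMr // mulrC ler_wpM2l.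
have -> : i'%:R * k'%:R / n%:R =
    i%:R * k%:R / n%:R + k%:R * (i'%:R - i%:R) / n%:R + i'%:R * (k'%:R - k%:R) / n%:R :> R.
  by field; lra.
have hi : 0 <= i'%:R - i%:R :> R by rewrite subr_ge0 ler_nat.
have hk : 0 <= k'%:R - k%:R :> R by rewrite subr_ge0 ler_nat.
have h1 : k%:R <= n%:R :> R by rewrite ler_nat; lia.
have h2 : i'%:R <= n%:R :> R by rewrite ler_nat; lia.
have a1 := ge0 k%:R (i'%:R - i%:R) (ler0n _ _) hi.
have a2 := ge0 i'%:R (k'%:R - k%:R) (ler0n _ _) hk.
have a3 := le1 k%:R (i'%:R - i%:R) h1 hi.
have a4 := le1 i'%:R (k'%:R - k%:R) h2 hk.
by move=> *; rewrite ler_norml; apply/andP; split; lra.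
Qed.

End Discrepancy.

(** * Uniform control of the discrepancy from a coarse grid *)

Section GridBound.
Variables (R : realFieldType) (n M : nat).
Hypotheses (n_gt0 : (0 < n)%N) (M_gt0 : (0 < M)%N).
Implicit Types (u v w : 'S_n).

(** Mesh size, rounded up so that M h > n and the M cells cover 0, ..., n. *)
Let h := (n %/ M).+1.

(** The term 2 h pays for moving both coordinates to the grid. The sum dominates the maximum over
    grid points and can be averaged termwise; [minn] keeps the points in range. *)
Definition grid_bound v : R :=
  2 * h%:R + \sum_(a < M) \sum_(b < M) `|disc R v (minn (a * h) n) (minn (b * h) n)|.

Lemma disc_le_grid v i k : (i <= n)%N -> (k <= n)%N -> `|disc R v i k| <= grid_bound v.
Proof.
move=> le_in le_kn.
have grid x : (x <= n)%N -> exists a : 'I_M, (minn (a * h) n <= x <= minn (a * h) n + h)%N.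
  move=> xn; have xM : (x %/ h < M)%N.
    by rewrite ltn_divLR // (leq_ltn_trans xn) // mulnC ltn_ceil.
  exists (Ordinal xM); have := divn_eq x h; have := ltn_pmod x (isT : (0 < h)%N).
  by move=> /=; lia.
have [a /andP[ai ia]] := grid i le_in; have [b /andP[bk kb]] := grid k le_kn.
set i0 := minn _ _ in ai ia; set k0 := minn _ _ in bk kb.
have lip := @disc_lipschitz R n v i0 i k0 k n_gt0 _ _.
have {lip} := lip ltac:(by rewrite ai) ltac:(by rewrite bk).
have ih : (i - i0)%:R <= h%:R :> R by rewrite ler_nat leq_subLR.
have kh : (k - k0)%:R <= h%:R :> R by rewrite ler_nat leq_subLR.
have le_sum : `|disc R v i0 k0| <=
    \sum_(a < M) \sum_(b < M) `|disc R v (minn (a * h) n) (minn (b * h) n)|.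
  rewrite (bigD1 a) //= (bigD1 b) //= -addrA lerDl addr_ge0 //.
    by apply: sumr_ge0 => ? _.
  by apply: sumr_ge0 => ? _; apply: sumr_ge0.
have := ler_normD (disc R v i k - disc R v i0 k0) (disc R v i0 k0).
by rewrite subrK /grid_bound; lra.
Qed.

(** Of 3 n / M, the mesh term 2 h contributes 2 n / M and the grid discrepancies n / M. *)
Lemma sum_grid_bound_le :
  \sum_(v : 'S_n) grid_bound v <= #|{: 'S_n}|%:R * (3 * n%:R / M%:R + 2 + M%:R ^+ 5).
Proof.
have n0 : (0 : R) < n%:R by rewrite ltr0n.
have M0 : (0 : R) < M%:R by rewrite ltr0n.
set N : R := #|{: 'S_n}|%:R; have N0 : 0 <= N by rewrite ler0n.
have hle : h%:R <= n%:R / M%:R + 1 :> R.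
  by rewrite /h -natr1 lerD2r ler_pdivlMr // -natrM ler_nat leq_trunc_div.
(* AM-GM with weight M^3, so that the M^2 grid points contribute n / M + M^5. *)
have sum_disc i k : (k <= n)%N ->
    \sum_(v : 'S_n) `|disc R v i k| <= N * (n%:R / M%:R ^+ 3 + M%:R ^+ 3).
  move=> kn; set d : R := n%:R / M%:R ^+ 3.
  have d0 : 0 < d by rewrite divr_gt0 // exprn_gt0.
  apply: (@le_trans _ _ (\sum_(v : 'S_n) (d + disc R v i k ^+ 2 / d))).
    apply: ler_sum => v _; rewrite -(ler_pM2r d0) mulrDl divfK ?gt_eqF //.
    rewrite -[X in _ + X]real_normK ?num_real //.
    have := sqr_ge0 (d - `|disc R v i k|); have : 0 <= `|disc R v i k| * d.
      by rewrite mulr_ge0 // ltW.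
    by nra.
  rewrite big_split /= sumr_const -mulr_suml -[X in X + _]mulr_natl -/N mulrDr lerD2l.
  rewrite ler_pdivrMr //; apply: le_trans (@sum_disc_sqr_le R n i k n_gt0 kn) _.
  have -> : N * M%:R ^+ 3 * d = n%:R * N by rewrite /d; field; lra.
  by [].
rewrite /grid_bound big_split /= sumr_const exchange_big /= -[X in X + _]mulr_natl -/N.
under eq_bigr do rewrite exchange_big /=.
have : \sum_(a < M) \sum_(b < M) \sum_(v : 'S_n) `|disc R v (minn (a * h) n) (minn (b * h) n)|
    <= N * (n%:R / M%:R + M%:R ^+ 5).
  apply: (@le_trans _ _ (\sum_(a < M) \sum_(b < M) (N * (n%:R / M%:R ^+ 3 + M%:R ^+ 3)))).
    by do 2!(apply: ler_sum => ? _); apply: sum_disc; rewrite geq_minr.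
  rewrite !sumr_const !card_ord -!mulrnA -[leLHS]mulr_natl natrM.
  by rewrite le_eqVlt; apply/orP; left; apply/eqP; field; lra.
have : N * (2 * h%:R) <= N * (2 * (n%:R / M%:R + 1)) by rewrite ler_wpM2l //; lra.
have -> : 3 * n%:R / M%:R = 3 * (n%:R / M%:R) :> R by rewrite mulrA.
by lra.
Qed.

(* rk v i k + rk u k j - k is i k / n + k j / n - k up to the discrepancies,
   that is (k / n) (i + j - n), which is at most (i + j - n)^+. *)
Lemma rk_star_le (star : 'S_n -> 'S_n -> 'S_n) u v i j : n != 2 ->
    is_demazure star -> (i <= n)%N -> (j <= n)%N ->
  (rk (star u v) i j)%:R <= (i + j - n)%:R + (grid_bound u + grid_bound v).
Proof.
move=> n2 ds le_in le_jn; have [k lek] := rk_star u v j n2 ds le_in.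
rewrite -(ler_nat R) !natrD.
have := disc_le_grid v le_in lek; have := disc_le_grid u lek le_jn.
rewrite !discE // !ler_norml => /andP[_ hu] /andP[_ hv].
have n0 : (0 : R) < n%:R by rewrite ltr0n.
set x : R := k%:R / n%:R.
have x0 : 0 <= x by rewrite divr_ge0.
have x1 : x <= 1 by rewrite ler_pdivrMr // mul1r ler_nat.
have e1 : i%:R * k%:R / n%:R = x * i%:R by rewrite /x; field; lra.
have e2 : k%:R * j%:R / n%:R = x * j%:R by rewrite /x; field; lra.
have e3 : k%:R = x * n%:R by rewrite /x; field; lra.
have : x * (i%:R + j%:R - n%:R) <= (i + j - n)%:R.
  have [le_n|lt_n] := leqP n (i + j)%N.
    by rewrite natrB // natrD ler_piMl // subr_ge0 -natrD ler_nat.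
  apply: (@le_trans _ _ 0); rewrite ?ler0n // mulr_ge0_le0 // subr_le0 -natrD ler_nat.
  exact: ltnW.
by move: hu hv; rewrite e1 e2 e3; lra.
Qed.

Lemma sum_ncoinv_le (star : 'S_n -> 'S_n -> 'S_n) : n != 2 -> is_demazure star ->
  \sum_(p : 'S_n * 'S_n) (ncoinv (star p.1 p.2))%:R <=
    4 * n%:R * (3 * n%:R / M%:R + 2 + M%:R ^+ 5) * #|{: 'S_n * 'S_n}|%:R :> R.
Proof.
move=> n2 ds; pose G := \sum_(v : 'S_n) grid_bound v.
apply: (@le_trans _ _
  (\sum_(u : 'S_n) \sum_(v : 'S_n) 2 * n%:R * (grid_bound u + grid_bound v))).
  rewrite pair_big /=; apply: ler_sum => -[u v] _ /=; apply: ncoinv_le => i j le_in le_jn.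
  exact: rk_star_le.
under eq_bigr do rewrite -mulr_sumr big_split /= sumr_const -/G.
rewrite -mulr_sumr big_split /= sumrMnl sumr_const -/G.
have := sum_grid_bound_le; rewrite -/G card_prod natrM -(mulr_natl G).
set N : R := #|{: 'S_n}|%:R; set B := _ + M%:R ^+ 5 => hG.
have -> : 2 * n%:R * (N * G + N * G) = (4 * n%:R * N) * G by ring.
have -> : 4 * n%:R * B * (N * N) = (4 * n%:R * N) * (N * B) by ring.
by rewrite ler_wpM2l // !mulr_ge0 ?ler0n.
Qed.

End GridBound.

(** * Expected number of non-inversions relative to the binomial coefficient *)

Section Mean.
Variable R : realType.
Implicit Types (n M : nat).

Lemma unif_mean_ninv n (star : 'S_n -> 'S_n -> 'S_n) :
  unif_mean (fun p : 'S_n * 'S_n => (ninv (star p.1 p.2))%:R) =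
    'C(n, 2)%:R - unif_mean (fun p : 'S_n * 'S_n => (ncoinv (star p.1 p.2))%:R) :> R.
Proof.
have N0 : #|{: 'S_n * 'S_n}|%:R != 0 :> R.
  by rewrite pnatr_eq0 -lt0n; apply/card_gt0P; exists (1%g, 1%g).
rewrite /unif_mean; apply: (mulIf N0); rewrite mulrBl !divfK //.
apply: (canRL (addrK _)); rewrite -big_split /= mulr_natr -sumr_const.
by apply: eq_bigr => p _; rewrite -natrD ninv_ncoinv.
Qed.

Lemma unif_mean_ncoinv_le n M (star : 'S_n -> 'S_n -> 'S_n) :
    (2 < n)%N -> (0 < M)%N -> is_demazure star ->
  unif_mean (fun p : 'S_n * 'S_n => (ncoinv (star p.1 p.2))%:R) / 'C(n, 2)%:R <=
    48 / M%:R + (32 + 16 * M%:R ^+ 5) / n%:R :> R.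
Proof.
move=> n2 M0 ds; have n0 : (2 : R) < n%:R by rewrite ltr_nat.
have M0' : (0 : R) < M%:R by rewrite ltr0n.
(* Dividing 4 n (3 n / M + 2 + M^5) by n^2 / 4 produces the constants 48, 32 and 16. *)
have C0 : n%:R ^+ 2 / 4 <= 'C(n, 2)%:R :> R.
  rewrite ler_pdivrMr // -natrX -natrM ler_nat.
  by have := bin2 n; have := mul_bin_diag n.-1 1; rewrite bin1; nia.
have N0 : (0 : R) < #|{: 'S_n * 'S_n}|%:R.
  by rewrite ltr0n; apply/card_gt0P; exists (1%g, 1%g).
have mean_le : unif_mean (fun p : 'S_n * 'S_n => (ncoinv (star p.1 p.2))%:R) <=
    4 * n%:R * (3 * n%:R / M%:R + 2 + M%:R ^+ 5) :> R.
  rewrite /unif_mean ler_pdivrMr //; apply: sum_ncoinv_le => //; lia.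
have C1 : 0 < 'C(n, 2)%:R :> R by rewrite ltr0n bin_gt0 ltnW.
rewrite ler_pdivrMr //; apply: le_trans mean_le _.
apply: le_trans (ler_wpM2l _ C0).
  by rewrite le_eqVlt; apply/orP; left; apply/eqP; field; lra.
by rewrite addr_ge0 // divr_ge0 ?addr_ge0 ?mulr_ge0 ?exprn_ge0 ?ler0n.
Qed.

End Mean.

Theorem theorem1p8 (R : realType) (star : forall n : nat, 'S_n -> 'S_n -> 'S_n)
    (star_demazure : forall n : nat, is_demazure (star n)) :
  exists eps : nat -> R,
    eps n @[n --> \oo] --> (0 : R) /\
    forall n : nat, (1 <= n)%N ->
      unif_mean (fun uv : 'S_n * 'S_n => (ninv (star n uv.1 uv.2))%:R)
        = 'C(n, 2)%:R * (1 - eps n).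
Proof.
pose q n : R :=
  unif_mean (fun p : 'S_n * 'S_n => (ncoinv (star n p.1 p.2))%:R) / 'C(n, 2)%:R.
exists q; split; last first.
  move=> n n1; rewrite unif_mean_ninv /q mulrBr mulr1; congr (_ - _).
  have [n2|n2] := ltnP 1 n; first by rewrite mulrC divfK // pnatr_eq0 -lt0n bin_gt0.
  (* For n = 1 the binomial vanishes, and [ninv_ncoinv] makes every [ncoinv] vanish with it. *)
  rewrite bin_small ?mul0r //.
  rewrite /unif_mean big1 ?mul0r // => p _.
  by have := ninv_ncoinv (star n p.1 p.2); rewrite bin_small //; case: ncoinv => // m; lia.
apply/cvgrPdist_le => e e0.
(* M is fixed before n, to bring 48 / M below e / 2; then n grows until the 1 / n term is below e /
   2 as well. *)
pose M := (Num.truncn (96 / e)).+1.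
have hM : 48 / M%:R <= e / 2.
  rewrite ler_pdivrMr ?ltr0n // mulrC mulrA ler_pdivlMr //.
  have : 96 / e <= M%:R by rewrite ltW // truncnS_gt.
  by rewrite ler_pdivrMr //; lra.
near=> n.
(* This also avoids n = 2, where the axioms leave [star u 1] undetermined. *)
have n2 : (2 < n)%N by near: n; exact: nbhs_infty_gt.
have n0 : (0 : R) < n%:R by rewrite ltr0n; lia.
rewrite sub0r normrN ger0_norm; last first.
  by rewrite /q /unif_mean !divr_ge0 ?ler0n ?sumr_ge0.
apply: le_trans (@unif_mean_ncoinv_le R n M _ n2 isT (star_demazure n)) _.
rewrite [e in leRHS]splitr lerD // ler_pdivrMr // [leRHS]mulrC -ler_pdivrMr ?divr_gt0 //.
by near: n; exact: nbhs_infty_ger.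
Unshelve. all: by end_near.
Qed.
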